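(* Let $k>0$, $l>0$, $\Omega=[-l,l]$, and let $f\in L^2(\mathbb{R})$ be supported in $\Omega$. Let $\sigma:\mathbb{R}\to[0,\infty)$ be locally integrable with $\sigma=0$ on $\Omega$ and $\sigma>0$ on $\mathbb{R}\setminus\Omega$, and put $\eta(x)=\left|\int_0^x\sigma(t)\,dt\right|$. Let $z=z_1+\mathrm{i}z_2$ with $z_1\ge 0$, $z_2>0$, and let $\tilde x=x+\frac{z}{k}\int_0^x\sigma(t)\,dt$. Let $u^a(\tilde x)$ be the PML solution associated with a radial kernel $\gamma_r$, and let $u^e(\tilde x)$ be the PML solution associated with the exponential kernel $\frac{1}{2c_\gamma^3}e^{-|s|/c_\gamma}$ (where $c_\gamma>0$, $c_\gamma k\neq 1$). Both are defined in the context. In each estimate $\tilde k$ is the complex number attached to the corresponding kernel as in the context. When $z_1/z_2$ is large enough, the PML solutions $u^a(\tilde x)$ and $u^e(\tilde x)$ decay exponentially as $|x|\to\infty$, in the sense of the following estimates. 1. If $\tilde k\in\mathbb{R}$ is positive, then for any $z_1\ge 0$, $z_2>0$ and all $|x|>l$, $$|u^a(\tilde x)|\le \frac{\sqrt{l}}{\sqrt{2}\,\tilde k}\,e^{-\frac{\tilde k}{k}z_2|\eta(x)|}\,\|f\|_{L^2(\Omega)},$$ $$|u^e(\tilde x)|\le \frac{\sqrt{l}}{\sqrt{2}\,\tilde k\,\left(1-(c_\gamma k)^2\right)^2}\,e^{-\frac{\tilde k}{k}z_2|\eta(x)|}\,\|f\|_{L^2(\Omega)}.$$ 2. If $\tilde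 k\in\mathbb{C}$ has positive imaginary part, $\Im(\tilde k)>0$, then for any $\lambda\in(0,1)$, whenever $\frac{z_1}{z_2}\ge -\frac{1}{1-\lambda}\frac{\Re(\tilde k)}{\Im(\tilde k)}$, for all $|x|>l$, $$|u^a(\tilde x)|\le \frac{\sqrt{l}}{\sqrt{2}\,|\tilde k|}\,e^{-\lambda\,\Im(\tilde k)\left(\left|x+\frac{z_1}{k}\eta(x)\right|-l\right)}\,\|f\|_{L^2(\Omega)},$$ $$|u^e(\tilde x)|\le \frac{\sqrt{l}}{\sqrt{2}\,|\tilde k|\,\left(1-(c_\gamma k)^2\right)^2}\,e^{-\lambda\,\Im(\tilde k)\left(\left|x+\frac{z_1}{k}\eta(x)\right|-l\right)}\,\|f\|_{L^2(\Omega)}.$$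
   Context: Nonlocal Helmholtz equation in one dimension: $\int_{\mathbb{R}}(u(x)-u(y))\gamma_r(x-y)\,dy-k^2u(x)=f(x)$, $x\in\mathbb{R}$. No explicit far-field condition is specified; the solution is assumed to be the outgoing one, and it is the one for which the representation formulas below hold. Radial kernel for $u^a$: $\gamma_r$ satisfies $\gamma_r(s)\ge0$; $\gamma_r(s)=\gamma_r(-s)$; $\gamma_r(s)=0$ for $|s|>\delta$ (for some $\delta>0$); and $\frac12\int_{\mathbb{R}}s^2\gamma_r(s)\,ds=1$. The number $\tilde k\in\mathbb{C}$: it is the solution, with nonnegative imaginary part, of $$\int_{\mathbb{R}}\left(1-e^{\mathrm{i}\tilde k s}\right)\gamma_r(s)\,ds=k^2.$$ For the exponential kernel $\gamma_r(s)=\frac{1}{2c_\gamma^3}e^{-|s|/c_\gamma}$ (which is not required to have finite horizon) it is $\tilde k=k\sqrt{1/(1-(c_\gamma k)^2)}$, with the branch of nonnegative imaginary part (positive if real). The function $G$: for $x_0,x\in\mathbb{R}$, $$G_{x_0}(x)=\begin{cases}-\dfrac{e^{\mathrm{i}\tilde kx_0}}{2\mathrm{i}\tilde k}\,e^{-\mathrm{i}\tilde kx}, & x\le x_0,\\[2mm] -\dfrac{e^{-\mathrm{i}\tilde kx_0}}{2\mathrm{i}\tilde k}\,e^{\mathrm{i}\tilde kx}, & x>x_0.\end{cases}$$ The average $u^a$: with $\kappa$ the even function given by $\kappa(t)=-\frac1{\tilde k}\int_t^{+\infty}\sin(\tilde k(t-s))\,\gamma_r(s)\,ds$ for $t>0$,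 set $u^a(x)=\int_{\mathbb{R}}u(t+x)\kappa(t)\,dt$, where $u$ is the solution of the nonlocal Helmholtz equation with kernel $\gamma_r$. It is given by the formula $$u^a(x)=\int_{\mathbb{R}}G_x(y)f(y)\,dy .$$ The solution $u^e$: the solution of the nonlocal Helmholtz equation with the exponential kernel. It is given by the formula $$u^e(x)=\int_{\mathbb{R}}\left(\frac{1}{(1-(c_\gamma k)^2)^2}\,G_x(y)+\frac{c_\gamma^2}{1-(c_\gamma k)^2}\,\mathcal{D}(y-x)\right)f(y)\,dy,$$ where $\mathcal{D}$ is the Dirac delta and $G$ is taken with the $\tilde k$ of the exponential kernel. These representation formulas are part of the given setting. PML solutions: for $|x|>l$, $u^a(\tilde x)$ and $u^e(\tilde x)$ denote the values at the complex point $\tilde x=x+\frac zk\int_0^x\sigma(t)\,dt$ of the analytic continuations of $u^a$ and $u^e$ from the real half-line $(l,\infty)$ if $x>l$, and from $(-\infty,-l)$ if $x<-l$. Since $f$ is supported in $[-l,l]$, the Dirac term does not contribute there, and the continuations are obtained by replacing $G_x(y)$, $y\in[-l,l]$, by $G_{\tilde x}(y)=-\frac{1}{2\mathrm{i}\tilde k}e^{\mathrm{i}\tilde k(\tilde x-y)}$ if $x>l$ and by $G_{\tilde x}(y)=-\frac{1}{2\mathrm{i}\tilde k}e^{-\mathrm{i}\tilde k(\tilde x-y)}$ if $x<-l$. *)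

(* Defs.v *)
From HB Require Import structures.
From mathcomp Require Import all_boot all_order all_algebra.
From mathcomp Require Import all_classical all_reals all_analysis.
From mathcomp.real_closed Require Import complex.

Set Implicit Arguments.
Unset Strict Implicit.
Unset Printing Implicit Defensive.

Import Order.TTheory GRing.Theory Num.Theory.
Import numFieldNormedType.Exports.
Import Normc.

Local Open Scope classical_set_scope.
Local Open Scope ring_scope.
Local Open Scope complex_scope.

Section Analytic.
Variable K : numFieldType.

(* Stated over a [numFieldType], whose topology is canonically that of its norm,
   and used below with K = R[i]. *)
Definition analytic_at (U : K -> K) (p : K) : Prop :=
  exists a : nat -> K, exists2 r : K, 0 < r &
    forall w : K, `|w - p| < r ->
      series (fun n => a n * (w - p) ^+ n) @ \oo --> U w.

Definition analytic_on_domain (D : set K) (U : K -> K) : Prop :=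
  [/\ open D, connected D & forall q, D q -> analytic_at U q].

End Analytic.

Section Defs.
Variable R : realType.
Local Notation C := R[i].
Local Notation mu := (@lebesgue_measure R).

Implicit Types (f g u : R -> C) (gam sigma : R -> R) (kt : C) (c k l : R).

Definition cexp (w : C) : C :=
  (expR (complex.Re w) * cos (complex.Im w))
    +i* (expR (complex.Re w) * sin (complex.Im w)).

Definition csin (w : C) : C :=
  (cexp ('i%C * w) - cexp (- ('i%C * w))) / (2 * 'i%C).

Definition cmeasurable g : Prop :=
  measurable_fun setT (fun x => complex.Re (g x)) /\
  measurable_fun setT (fun x => complex.Im (g x)).

Definition cintegrable (D : set R) g : Prop :=
  mu.-integrable D (fun x => (complex.Re (g x))%:E) /\
  mu.-integrable D (fun x => (complex.Im (g x))%:E).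

Definition cintegral (D : set R) g : C :=
  (\int[mu]_(x in D) complex.Re (g x))
    +i* (\int[mu]_(x in D) complex.Im (g x)).

Definition in_L2 f : Prop :=
  cmeasurable f /\ finite_norm mu 2%:E (fun x => normc (f x)).

Definition L2norm (D : set R) f : R :=
  fine (Lnorm mu 2%:E (EFin \o ((fun x => normc (f x)) \_ D))).

(* Principal value at [a]. The standing assumptions on a radial kernel only make
   s^2 * gamma(s) integrable at the origin, so the integrals against gamma in
   the Helmholtz equation and in the definition of the wave number need not
   converge absolutely there. When they do, this is the Lebesgue integral. *)
Definition is_pv_integral (a : R) g (v : C) : Prop :=
  (forall e : R, 0 < e -> cintegrable [set y | e < `|y - a|] g) /\
  (cintegral [set y | e < `|y - a|] g : C^o) @[e --> 0^'+] --> (v : C^o).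

Definition is_helmholtz_solution gam k f u : Prop :=
  cmeasurable u /\
  {ae mu, forall x, exists2 I : C,
    is_pv_integral x (fun y => (u x - u y) * (gam (x - y))%:C) I &
    I - (k ^+ 2)%:C * u x = f x}.

Definition is_radial_kernel gam : Prop :=
  [/\ measurable_fun setT gam,
      forall s, 0 <= gam s,
      forall s, gam (- s) = gam s,
      exists2 delta, 0 < delta & forall s, delta < `|s| -> gam s = 0 &
      ((2^-1)%:E * \int[mu]_s (s ^+ 2 * gam s)%:E = 1)%E].

Definition is_radial_wavenumber gam k kt : Prop :=
  0 <= complex.Im kt /\
  is_pv_integral 0 (fun s => (1 - cexp ('i%C * kt * s%:C)) * (gam s)%:C)
    (k ^+ 2)%:C.

Definition exp_kernel c (s : R) : R := (2 * c ^+ 3)^-1 * expR (- `|s| / c).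

(* [sqrtC] is the square root with nonnegative imaginary part, and the
   nonnegative one on nonnegative reals. *)
Definition exp_wavenumber c k : C :=
  k%:C * sqrtC ((1 / (1 - (c * k) ^+ 2))%:C : C).

Definition green kt (x0 x : R) : C :=
  if x <= x0
  then - (cexp ('i%C * kt * x0%:C) / (2 * 'i%C * kt)) * cexp (- ('i%C * kt * x%:C))
  else - (cexp (- ('i%C * kt * x0%:C)) / (2 * 'i%C * kt)) * cexp ('i%C * kt * x%:C).

(* The even extension of the formula for t > 0; the value at 0 is irrelevant. *)
Definition kappa kt gam (t : R) : C :=
  - (1 / kt) * cintegral `]`|t|, +oo[
    (fun s => csin (kt * (`|t| - s)%:C) * (gam s)%:C).

Definition average kt gam u (x : R) : C :=
  cintegral setT (fun t => u (t + x) * kappa kt gam t).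

(* f is an element of L^2, so the representation formulas hold for almost every
   x, and analytic continuations (below) extend u up to a null set. *)
Definition radial_representation kt gam f u : Prop :=
  {ae mu, forall x,
    average kt gam u x = cintegral setT (fun y => green kt x y * f y)}.

(* The term in [f x] is the contribution of the Dirac delta at x. *)
Definition exp_representation c k f u : Prop :=
  {ae mu, forall x,
    u x = (1 / (1 - (c * k) ^+ 2) ^+ 2)%:C
            * cintegral setT (fun y => green (exp_wavenumber c k) x y * f y)
          + (c ^+ 2 / (1 - (c * k) ^+ 2))%:C * f x}.

Definition continuation_value u (J : set R) (p v : C) : Prop :=
  exists (D : set C) (U : C -> C),
    analytic_on_domain D U /\
    [/\ forall t, J t -> D t%:C,
        D p,
        {ae mu, forall t, J t -> U t%:C = u t} &
        v = U p].

(* The oriented integral of sigma from 0 to x. *)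
Definition primitive sigma (x : R) : R :=
  if 0 <= x then \int[mu]_(t in `[0, x]) sigma t
  else - \int[mu]_(t in `[x, 0]) sigma t.

Definition pml_eta sigma (x : R) : R := `|primitive sigma x|.

Definition pml_coord k (z : C) sigma (x : R) : C :=
  x%:C + z / k%:C * (primitive sigma x)%:C.

(* [V x] is the value u(x~), for every |x| > l. *)
Definition is_pml_solution k l (z : C) sigma u (V : R -> C) : Prop :=
  forall x, l < `|x| ->
    (l < x /\
       continuation_value u `]l, +oo[ (pml_coord k z sigma x) (V x)) \/
    (x < - l /\
       continuation_value u `]-oo, (- l)[ (pml_coord k z sigma x) (V x)).

End Defs.

(* Main.v *)
Require Import Defs.
From HB Require Import structures.
From mathcomp Require Import all_boot all_order all_algebra.
From mathcomp Require Import all_classical all_reals all_analysis.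
From mathcomp.real_closed Require Import complex.
From mathcomp Require Import measurable_realfun ring lra.

Import Order.TTheory GRing.Theory Num.Theory.
Import numFieldNormedType.Exports.
Import Normc.

Local Open Scope classical_set_scope.
Local Open Scope ring_scope.
Local Open Scope complex_scope.

(** Outside the support of f the solution is a pure outgoing exponential. For
x > l every point y of the support lies to the left of x, so Green's function
factors and the representation formula reads, for almost every x > l,
    u(x) = A e^(i kt x),
    A = - c0 / (2 i kt) * (integral over [-l, l] of e^(- i kt y) f(y) dy),
with c0 = 1 for the averaged solution and c0 = 1 / (1 - (c k)^2)^2 for the
exponential kernel, whose Dirac term only sees f(x) = 0. For x < -l the sign of
i kt is reversed.

The right-hand side is entire, and an analytic continuation of u along a
connected open set agrees with it at almost every point of a real half-line.
Zeros of a nonzero power series are isolated ([pseries_coef_eq0]), hence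
[identity_theorem] forces the continuation to be A e^(i kt w) everywhere
([continuation_value_cexp]), in particular at the PML point x~. This needs the
complex exponential, given by its real and imaginary parts, to be analytic; the
remainder of its power series is estimated by successive integration along the
ray from 0 ([Re_remainder_le]).

It remains to measure A e^(i kt x~). Cauchy-Schwarz on [-l, l] costs a factor
sqrt (2 l), and |e^(- i kt y)| <= e^(Im kt * l) there, so
    |A| <= c0 / (2 |kt|) * e^(Im kt * l) * sqrt (2 l) * norm f
([normc_cintegral_cexp_le]), while |e^(i kt x~)| = e^(- Im (kt x~)) with
    Im (kt x~) = Im kt * (|x| + z1 eta / k) + Re kt * z2 eta / k
on both half-lines up to the sign absorbed in the wave ([exterior_bound]). For
real kt only the last term survives. For Im kt > 0 the last term may be negative,
and the condition on z1 / z2 says that a fraction 1 - lambda of the term in z1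
pays for it ([pml_exponent_le]). *)

Set Implicit Arguments.
Unset Strict Implicit.

(** * The identity theorem for power series *)

Section IdentityTheorem.
Variable K : numFieldType.
Implicit Types (a : nat -> K) (U V : K -> K) (D : set K) (p q : K).

Lemma geometric_tail_le (x : K) (m N : nat) : 0 <= x -> x <= 2^-1 ->
  \sum_(m <= n < N) x ^+ n <= 2 * x ^+ m.
Proof.
move=> x0 x2; have xn n : 0 <= x ^+ n by exact: exprn_ge0.
have [mN|Nm] := leqP m N; last by rewrite big_geq ?mulr_ge0 // ltnW.
(* Adding the remainder 2 x ^ N makes the bound inductive. *)
suff : \sum_(m <= n < N) x ^+ n + 2 * x ^+ N <= 2 * x ^+ m.
  by apply: le_trans; rewrite lerDl mulr_ge0.
elim: N mN => [|N IH]; first by rewrite leqn0 => /eqP ->; rewrite big_geq ?add0r.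
rewrite leq_eqVlt => /orP[/eqP ->|]; first by rewrite big_geq ?add0r.
rewrite ltnS => mN; apply: le_trans (IH mN).
rewrite big_nat_recr //= -addrA lerD2l [leRHS]mulr_natl mulr2n lerD2l.
by rewrite exprS mulrA -[leRHS]mul1r ler_wpM2r // mulrC -ler_pdivlMr // mul1r.
Qed.

(** Norms and radii are positive elements of a field that is only partially
ordered, so minima are taken among comparable elements. *)
Lemma exists_lower_bound (e1 e2 : K) : 0 < e1 -> 0 < e2 ->
  exists2 e, 0 < e & e <= e1 /\ e <= e2.
Proof.
move=> e10 e20; have [e12|e12] := real_leP (gtr0_real e10) (gtr0_real e20).
  by exists e1.
by exists e2 => //; split => //; exact: ltW.
Qed.

(** The first nonzero coefficient a_n would dominate near p: the terms of a
convergent series are bounded, so the tail beyond n is O(|w - p|^(n + 1)), and at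
a zero w of the sum this gives |a_n| = O(|w - p|). *)
Lemma pseries_coef_eq0 a U p (r : K) : 0 < r ->
  (forall w, `|w - p| < r ->
    series (fun n => a n * (w - p) ^+ n) @ \oo --> U w) ->
  (forall e, 0 < e -> exists2 w, 0 < `|w - p| < e & U w = 0) ->
  forall n, a n = 0.
Proof.
move=> r0 aU zeros; pose rho := r / 2.
have rho0 : 0 < rho by rewrite divr_gt0.
have rhor : rho < r by rewrite ltr_pdivrMr // ltr_pMr // ltr1n.
(* Convergence at p + rho bounds the coefficients geometrically. *)
have [M M0 aM] : exists2 M : K, 0 < M & forall n, `|a n| <= M / rho ^+ n.
  have : `|p + rho - p| < r by rewrite addrC addKr gtr0_norm.
  move/aU => /cvgP /(@cvg_series_cvg_0 K K^o) /cvgP /cvg_seq_bounded.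
  move=> /ex_strict_bound_gt0 [M M0 aM]; exists M => // n.
  rewrite ler_pdivlMr ?exprn_gt0 //.
  have /ltW := aM n I; rewrite addrC addKr normrM normrX.
  by rewrite (gtr0_norm rho0).
suff a0 n : (forall i, (i < n)%N -> a i = 0) -> a n = 0.
  move=> n; have [m] := ubnP n; elim: m n => // m IH n nm.
  by apply: a0 => i ni; apply: IH; rewrite (leq_trans ni).
move=> ai0.
(* Compare a_n (w - p)^n with the tail of partial sums that tend to 0. *)
have key w : 0 < `|w - p| -> `|w - p| <= rho / 2 -> U w = 0 ->
    `|a n| <= 2 * M / rho ^+ n.+1 * `|w - p|.
  set v := w - p => v0 vrho Uw0.
  have vr : `|v| < r.
    by apply: (le_lt_trans vrho); rewrite (lt_trans _ rhor) // ltr_pdivrMr // ltr_pMr // ltr1n.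
  have : series (fun n => a n * v ^+ n) @ \oo --> (0 : K) by rewrite -Uw0; exact: aU.
  move=> /(@cvgr_dist_lt K K^o) cv.
  have x0 : 0 <= `|v| / rho by rewrite divr_ge0 // ltW.
  have x2 : `|v| / rho <= 2^-1 by rewrite ler_pdivrMr // mulrC.
  suff : `|a n * v ^+ n| <= M * (2 * (`|v| / rho) ^+ n.+1).
    rewrite normrM normrX -ler_pdivlMr ?exprn_gt0 // => /le_trans; apply.
    rewrite le_eqVlt; apply/orP; left; apply/eqP.
    rewrite exprMn exprVn [`|v| ^+ n.+1]exprS.
    by field; rewrite ?expf_neq0 // ?gt_eqF.
  apply/ler_addgt0Pr => e e0.
  have [N _ HN] := cv _ e0.
  have /= := HN (N + n.+1)%N (leq_addr _ _).
  rewrite sub0r normrN /series /= (big_cat_nat (n := n.+1)) //=; last by rewrite leq_addl.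
  rewrite big_nat_recr //= big_nat big1 ?add0r; last first.
    by move=> i /ai0 ->; rewrite mul0r.
  set T := \sum_(_ <= _ < _) _ => /ltW aT.
  have -> : a n * v ^+ n = - T + (a n * v ^+ n + T) by rewrite addrC addrK.
  apply: (le_trans (ler_normD _ _)); rewrite normrN; apply: lerD => //.
  apply: (le_trans (ler_norm_sum _ _ _)).
  apply: (@le_trans _ _ (\sum_(n.+1 <= i < N + n.+1) M * (`|v| / rho) ^+ i)).
    apply: ler_sum => i _; rewrite normrM normrX exprMn exprVn mulrCA.
    by rewrite [leLHS]mulrC ler_wpM2l.
  by rewrite -mulr_sumr ler_pM2l //; exact: geometric_tail_le.
apply/eqP; apply/negPn/negP => an0.
pose B := 2 * M / rho ^+ n.+1.
have B0 : 0 < B by rewrite divr_gt0 ?exprn_gt0 // mulr_gt0.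
have e20 : 0 < `|a n| / B by rewrite divr_gt0 // normr_gt0.
have e10 : 0 < rho / 2 by rewrite divr_gt0.
have [e e0 [e1 e2]] := exists_lower_bound e10 e20.
have [w /andP[w0 we] Uw0] := zeros e e0.
have := key w w0 (le_trans (ltW we) e1) Uw0; rewrite -/B => anB.
have : B * `|w - p| < `|a n|.
  by rewrite mulrC -ltr_pdivlMr // (lt_le_trans we).
by move=> /(le_lt_trans anB); rewrite ltxx.
Qed.

Lemma analytic_atB U V p : analytic_at U p -> analytic_at V p ->
  analytic_at (fun w => U w - V w) p.
Proof.
move=> [a [r r0 aU]] [b [s s0 bV]].
have [e e0 [er es]] := exists_lower_bound r0 s0.
exists (fun n => a n - b n), e => // w we.
have -> : series (fun n => (a n - b n) * (w - p) ^+ n)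
    = series (fun n => a n * (w - p) ^+ n) \- series (fun n => b n * (w - p) ^+ n).
  by apply/funext => N /=; rewrite /series /= -sumrB; apply: eq_bigr => i _; rewrite mulrBl.
by apply: (@cvgB K K^o); [apply: aU|apply: bV]; exact: lt_le_trans we _.
Qed.

Lemma analytic_zeros_near U p : analytic_at U p ->
  (forall e, 0 < e -> exists2 w, 0 < `|w - p| < e & U w = 0) ->
  exists2 e, 0 < e & forall w, `|w - p| < e -> U w = 0.
Proof.
move=> [a [r r0 aU]] zeros; exists r => // w wr.
have a0 := pseries_coef_eq0 r0 aU zeros.
have := aU w wr; under eq_fun do rewrite a0 mul0r.
rewrite (_ : series _ = fun=> 0); last by apply/funext => N; rewrite /series /= big1.
by move=> cv0; apply: (@cvg_unique K _ _ _ _ _ cv0 (cvg_cst _)).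
Qed.

(** The points of D near which U and V coincide form an open set, which is also
closed in D because its limit points are accumulation points of zeros of U - V. *)
Lemma identity_theorem D U V p : analytic_on_domain D U ->
  (forall q, D q -> analytic_at V q) -> D p ->
  (forall e, 0 < e -> exists2 w, 0 < `|w - p| < e & U w = V w) ->
  forall q, D q -> U q = V q.
Proof.
move=> [openD connD anU] anV Dp accp.
pose loc q := exists2 e : K, 0 < e & forall w, `|w - q| < e -> U w = V w.
have acc_loc q : D q ->
    (forall e, 0 < e -> exists2 w, 0 < `|w - q| < e & U w = V w) -> loc q.
  move=> Dq acc.
  have [||e e0 He] := @analytic_zeros_near (fun w => U w - V w) q.
  - by apply: analytic_atB; [exact: anU|exact: anV].
  - by move=> e /acc [w w1 w2]; exists w => //; rewrite w2 subrr.
  - by exists e => // w /He /subr0_eq.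
have loc_int q e : (forall w, `|w - q| < e -> U w = V w) ->
    forall w, `|w - q| < e -> loc w.
  move=> He w we; exists (e - `|w - q|); first by rewrite subr_gt0.
  move=> w'; rewrite ltrBrDr => we'; apply: He.
  by apply: le_lt_trans we'; rewrite (le_trans _ (ler_normD _ _)) // addrA subrK.
suff -> : D = D `&` loc by move=> q [_ [e e0 He]]; apply: He; rewrite subrr normr0.
apply/esym/connD.
- by exists p; split => //; exact: acc_loc.
- exists loc => //; rewrite openE => q [e e0 He].
  apply/(@nbhs_ballP K K^o); exists e => //= w; rewrite /ball /= distrC.
  exact: loc_int.
- exists (closure (D `&` loc)); first exact: closed_closure.
  apply/seteqP; split => q.
    by move=> Hq; split; [case: Hq|exact: subset_closure].
  move=> [Dq clq]; split => //.
  have [[_ //]|nq] := pselect ((D `&` loc) q).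
  apply: acc_loc => // e e0.
  have /clq [w [[Dw lw]]] : nbhs q (ball q e).
    by apply/(@nbhs_ballP K K^o); exists e.
  rewrite /ball /= distrC => we; exists w.
    rewrite we andbT normr_gt0 subr_eq0; apply/eqP => wq.
    by apply: nq; rewrite -wq.
  by case: lw => e' e'0; apply; rewrite subrr normr0.
Qed.

End IdentityTheorem.

(** * Analyticity of the complex exponential *)

Section ComplexExponential.
Variable R : realType.
Implicit Types (a b u v w z : R[i]) (t : R).
Local Notation Re := complex.Re.
Local Notation Im := complex.Im.

Lemma ReM v w : Re (v * w) = Re v * Re w - Im v * Im w.
Proof. by case: v w => [? ?] [? ?]. Qed.

Lemma ImM v w : Im (v * w) = Re v * Im w + Im v * Re w.
Proof. by case: v w => [? ?] [? ?]. Qed.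

Lemma ReD v w : Re (v + w) = Re v + Re w.
Proof. by case: v w => [? ?] [? ?]. Qed.

Lemma ImD v w : Im (v + w) = Im v + Im w.
Proof. by case: v w => [? ?] [? ?]. Qed.

Lemma normr_normc z : `|z| = (normc z)%:C.
Proof. by case: z. Qed.

Lemma normc_ge0 z : 0 <= normc z.
Proof. by case: z => ? ?; exact: sqrtr_ge0. Qed.

Lemma Re_le_normc z : Re z <= normc z.
Proof.
case: z => x y /=; rewrite (le_trans (ler_norm _)) // -sqrtr_sqr.
by rewrite ler_wsqrtr // lerDl sqr_ge0.
Qed.

Lemma normc_Re_conj z : normc z ^+ 2 = Re (conjc z * z).
Proof. by case: z => x y /=; rewrite sqr_sqrtr ?addr_ge0 ?sqr_ge0 //; ring. Qed.

Lemma Re_conj z : Re (conjc z) = Re z.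
Proof. by case: z. Qed.

Lemma Im_conj z : Im (conjc z) = - Im z.
Proof. by case: z. Qed.

Lemma normc_conj z : normc (conjc z) = normc z.
Proof. by case: z => x y /=; rewrite sqrrN. Qed.

Lemma cexpD v w : cexp (v + w) = cexp v * cexp w.
Proof.
case: v w => [a b] [c d]; rewrite /cexp /= expRD cosD sinD.
by apply/eqP; rewrite eq_complex /=; apply/andP; split; apply/eqP; ring.
Qed.

Lemma cexp0 : cexp 0 = 1 :> R[i].
Proof. by rewrite /cexp /= expR0 cos0 sin0 mulr1 mulr0. Qed.

Lemma normc_cexp w : normc (cexp w) = expR (Re w).
Proof.
case: w => a b; rewrite /cexp /= !exprMn -mulrDr cos2Dsin2 mulr1 sqrtr_sqr.
by rewrite ger0_norm // expR_ge0.
Qed.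

Let coef w n : R[i] := w ^+ n / (n`!)%:R.

(** Following the remainder along the ray t |-> t w reduces its estimate to
calculus of a real variable. *)
Let remainder w n t : R[i] :=
  cexp (t%:C * w) - \sum_(0 <= i < n) t%:C ^+ i * coef w i.

Lemma is_derive_mulr (c t : R) : is_derive t 1 (fun s : R => s * c) c.
Proof.
have -> : (fun s : R => s * c) = c \*: (@id R).
  by apply/funext => s /=; rewrite mulrC.
by apply: is_derive_eq; rewrite scaler1.
Qed.

Lemma is_derive_Re_cexp u w t :
  is_derive t 1 (fun s : R => Re (u * cexp (s%:C * w))) (Re (u * w * cexp (t%:C * w))).
Proof.
case: u w => [u1 u2] [a b].
have -> : (fun s : R => Re ((u1 +i* u2) * cexp (s%:C * (a +i* b)))) =
    (fun s => expR (s * a) * (u1 * cos (s * b) - u2 * sin (s * b))).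
  apply/funext => s; rewrite ReM /cexp /= !mul0r addr0 subr0; ring.
have de := @is_derive1_comp R expR (fun s => s * a) t _ _
  (is_derive_expR (t * a)) (is_derive_mulr a t).
have dc := @is_derive1_comp R cos (fun s => s * b) t _ _
  (is_derive_cos (t * b)) (is_derive_mulr b t).
have ds := @is_derive1_comp R sin (fun s => s * b) t _ _
  (is_derive_sin (t * b)) (is_derive_mulr b t).
have dB := is_deriveB (is_deriveZ u1 dc) (is_deriveZ u2 ds).
have dM := is_deriveM de dB.
apply: (is_derive_eq dM).
rewrite !ReM /cexp /= !mul0r addr0 subr0.
set e := expR _; set c := cos _; set d := sin _.
rewrite -[LHS]/(e * (u1 * (- d * b) - u2 * (c * b)) + (u1 * c - u2 * d) * (e * a)).
ring.
Qed.

Lemma is_derive_Re_monomial z n t :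
  is_derive t 1 (fun s : R => Re (z * s%:C ^+ n.+1)) (n.+1%:R * t ^+ n * Re z).
Proof.
have D := is_deriveZ (Re z) (is_deriveX n.+1 (is_derive_id t 1)).
set F := (X in is_derive _ _ X) in D.
have -> : (fun s : R => Re (z * s%:C ^+ n.+1)) = F.
  apply/funext => s; rewrite -rmorphXn ReM /= mulr0 subr0.
  by rewrite /F -[RHS]/(_ * _) exprfctE.
by apply: (is_derive_eq D); rewrite -[LHS]/(_ * (_ * _)) mulr1 mulrC.
Qed.

Lemma coefS w n : coef w n.+1 * n.+1%:R = w * coef w n.
Proof.
rewrite /coef factS natrM exprS invfM [_^-1 * _]mulrC !mulrA divfK //.
Qed.

Lemma is_derive_Re_partial u w n t :
  is_derive t 1 (fun s : R => Re (u * \sum_(0 <= i < n.+1) s%:C ^+ i * coef w i))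
    (Re (u * w * \sum_(0 <= i < n) t%:C ^+ i * coef w i)).
Proof.
elim: n => [|n IH].
  have -> : (fun s : R => Re (u * \sum_(0 <= i < 1) s%:C ^+ i * coef w i))
      = cst (Re (u * coef w 0)).
    by apply/funext => s; rewrite big_nat1 expr0 mul1r.
  by rewrite big_geq // mulr0; exact: is_derive_cst.
have -> : (fun s : R => Re (u * \sum_(0 <= i < n.+2) s%:C ^+ i * coef w i))
    = (fun s : R => Re (u * \sum_(0 <= i < n.+1) s%:C ^+ i * coef w i))
      + (fun s : R => Re (u * coef w n.+1 * s%:C ^+ n.+1)).
  apply/funext => s; rewrite -[RHS]/(_ + _) -ReD big_nat_recr //=; congr Re; ring.
apply: (is_derive_eq (is_deriveD IH (is_derive_Re_monomial _ _ _))).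
rewrite [in RHS]big_nat_recr //= mulrDr ReD; congr (_ + _).
have -> : u * w * (t%:C ^+ n * coef w n) = u * coef w n.+1 * (n.+1%:R * t ^+ n)%:C.
  rewrite rmorphM rmorphXn rmorph_nat.
  transitivity (u * (w * coef w n) * t%:C ^+ n); last rewrite -coefS; ring.
by rewrite [in RHS]ReM [Re _%:C]/= [Im _%:C]/= mulr0 subr0 mulrC.
Qed.

(** Along the ray, d/dt of the remainder of order n + 1 is w times the remainder
of order n. The multiplier u makes the statement cover every real component of
the remainder at once. *)
Lemma is_derive_Re_remainder u w n t :
  is_derive t 1 (fun s => Re (u * remainder w n.+1 s)) (Re (u * w * remainder w n t)).
Proof.
have -> : (fun s => Re (u * remainder w n.+1 s)) =
    (fun s : R => Re (u * cexp (s%:C * w)))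
    - (fun s : R => Re (u * \sum_(0 <= i < n.+1) s%:C ^+ i * coef w i)).
  apply/funext => s; rewrite -[RHS]/(_ - _) /remainder mulrBr.
  by case: (u * _) (u * _) => [? ?] [? ?].
apply: (is_derive_eq (is_deriveB (is_derive_Re_cexp u w t) (is_derive_Re_partial u w n t))).
by rewrite /remainder mulrBr; case: (u * w * _) (u * w * _) => [? ?] [? ?].
Qed.

Lemma le_of_derive_le (g dg : R -> R) (c : R) n :
  (forall t, is_derive t 1 g (dg t)) ->
  (forall t, 0 <= t <= 1 -> dg t <= c * (t ^+ n / n`!%:R)) ->
  forall t, 0 <= t <= 1 -> g t - g 0 <= c * (t ^+ n.+1 / n.+1`!%:R).
Proof.
move=> Dg le_dg t /andP[t0 t1].
pose h (s : R) := c / n.+1`!%:R * s ^+ n.+1 - g s.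
have Dh (s : R) : is_derive s 1 h (c * (s ^+ n / n`!%:R) - dg s).
  have D := is_deriveB (is_deriveZ (c / n.+1`!%:R) (is_deriveX n.+1 (is_derive_id s 1)))
    (Dg s).
  set F := (X in is_derive _ _ X) in D.
  have -> : h = F.
    by apply/funext => x; rewrite /h /F -[RHS]/(_ * _ - _) exprfctE.
  apply: (is_derive_eq D); rewrite -[X in X - _]/(_ * (_ * _)) mulr1; congr (_ - _).
  have : n.+1%:R != 0 :> R by rewrite pnatr_eq0.
  have : n`!%:R != 0 :> R by rewrite pnatr_eq0 -lt0n fact_gt0.
  by rewrite factS natrM /=; move: n.+1%:R => p; move: n`!%:R => q q0 p0; field; apply/andP.
suff : h 0 <= h t.
  by rewrite /h expr0n /= mulr0 mulrA [c * _ / _]mulrAC; lra.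
apply: (@ger0_derive1_ndecr R h 0 1 _ _ _ 0 t) => //.
- move=> x; rewrite in_itv /= => /andP[x0 x1].
  by rewrite derive1E; case: (Dh x) => _ ->; rewrite subr_ge0 le_dg // !ltW.
- by apply: derivable_within_continuous => x _; case: (Dh x).
Qed.

Lemma remainder0 w n : remainder w n.+1 0 = 0.
Proof.
rewrite /remainder mul0r cexp0 big_nat_recl //= expr0 mul1r big1 ?addr0.
  by rewrite /coef expr0 divr1 subrr.
by move=> i _; rewrite exprS !mul0r.
Qed.

(** Induction on n: integrate the derivative of the remainder from 0, where the
remainder of positive order vanishes. Bounding Re (u z) for all u rather than Re
and Im separately keeps the constant at normc w ^ n. *)
Lemma Re_remainder_le w n u t : 0 <= t <= 1 ->
  Re (u * remainder w n t) <=
    normc u * normc w ^+ n * expR (normc w) * (t ^+ n / n`!%:R).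
Proof.
elim: n u t => [|n IH] u t t01.
  rewrite /remainder big_geq // subr0 !expr0 divr1 !mulr1.
  apply: (le_trans (Re_le_normc _)); rewrite normcM ler_wpM2l ?normc_ge0 //.
  rewrite normc_cexp ler_expR ReM /= mul0r subr0.
  case/andP: t01 => t0 t1; apply: (@le_trans _ _ (t * normc w)).
    by rewrite ler_wpM2l // Re_le_normc.
  by rewrite ler_piMl // normc_ge0.
have /(_ (normc u * normc w ^+ n.+1 * expR (normc w))) :=
  le_of_derive_le (is_derive_Re_remainder u w n).
move=> /(_ n) /(_ _ t t01); rewrite remainder0 mulr0 subr0; apply => s s01.
by apply: (le_trans (IH _ _ s01)); rewrite normcM exprS !mulrA.
Qed.

Lemma normc_exp_remainder_le w n :
  normc (cexp w - series (fun i => w ^+ i / i`!%:R) n)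
    <= expR (normc w) * (normc w ^+ n / n`!%:R).
Proof.
have -> : cexp w - series (fun i => w ^+ i / i`!%:R) n = remainder w n 1.
  rewrite /remainder mul1r /series /=; congr (_ - _); apply: eq_bigr => i _.
  by rewrite expr1n mul1r.
(* Taking u = conjc z turns the bound on Re (u z) into one on normc z ^ 2. *)
set z := remainder _ _ _.
have [->|z0] := eqVneq (normc z) 0.
  by rewrite mulr_ge0 ?expR_ge0 // divr_ge0 // exprn_ge0 // normc_ge0.
have zp : 0 < normc z by rewrite lt_def z0 normc_ge0.
rewrite -(ler_pM2l zp) -expr2 normc_Re_conj.
have t1 : 0 <= (1:R) <= 1 by rewrite ler01 lexx.
apply: (le_trans (Re_remainder_le w n (conjc z) t1)).
by rewrite normc_conj expr1n le_eqVlt; apply/orP; left; apply/eqP; ring.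
Qed.

Lemma cexp_series w :
  (series (fun i => w ^+ i / i`!%:R) : nat -> R[i]^o) @ \oo --> (cexp w : R[i]^o).
Proof.
apply/(@cvgrPdist_lt R[i] R[i]^o) => -[e e'].
rewrite ltcE /= => /andP[/eqP -> e0].
have : expR (normc w) * exp_coeff (normc w) n @[n --> \oo] --> (0 : R).
  rewrite -[X in _ --> X](mulr0 (expR (normc w))); apply: cvgMr.
  exact: cvg_series_cvg_0 (is_cvg_series_exp_coeff _).
move=> /(@cvgrPdist_lt R R^o) /(_ _ e0) [N _ HN]; exists N => // n /HN.
rewrite /= sub0r normrN normr_normc -/(real_complex R e) ltcR.
by apply: le_lt_trans; apply: le_trans (ler_norm _); exact: normc_exp_remainder_le.
Qed.

Lemma analytic_cexp A b p : analytic_at (fun w => A * cexp (b * w)) p.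
Proof.
exists (fun n => A * cexp (b * p) * (b ^+ n / n`!%:R)), 1 => // w _.
have -> : series (fun n => A * cexp (b * p) * (b ^+ n / n`!%:R) * (w - p) ^+ n)
    = (fun n => A * cexp (b * p) * series (fun i => (b * (w - p)) ^+ i / i`!%:R) n).
  apply/funext => n; rewrite /series /= mulr_sumr; apply: eq_bigr => i _.
  by rewrite exprMn; ring.
have -> : A * cexp (b * w) = A * cexp (b * p) * cexp (b * (w - p)).
  by rewrite -mulrA -cexpD -mulrDr addrCA subrr addr0.
by apply: (@cvgM R[i] _ _ _ (cst (A * cexp (b * p)))); [exact: cvg_cst|exact: cexp_series].
Qed.

End ComplexExponential.

(** * Continuation from almost every point of a half-line *)

Section Continuation.
Variable R : realType.
Implicit Types (P Q : R -> Prop) (u : R -> R[i]) (J : set R).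
Local Notation mu := (@lebesgue_measure R).

Lemma ae_imply P Q : (forall x, P x -> Q x) ->
  {ae mu, forall x, P x} -> {ae mu, forall x, Q x}.
Proof. by move=> H p; apply: (@filterS _ (almost_everywhere mu) _ _ _ H p). Qed.

Lemma ae_imply2 P Q (S : R -> Prop) : (forall x, P x -> Q x -> S x) ->
  {ae mu, forall x, P x} -> {ae mu, forall x, Q x} -> {ae mu, forall x, S x}.
Proof.
move=> H p q.
by apply: (@filterS2 _ (almost_everywhere mu) _ _ _ _ H p q).
Qed.

(** A nonempty open interval is not negligible. *)
Lemma ae_exists_itv P (a b : R) : a < b -> {ae mu, forall x, P x} ->
  exists2 x, a < x < b & P x.
Proof.
move=> ab aeP; apply: contrapT => noP.
have null : mu.-negligible `]a, b[%classic.
  apply: negligibleS aeP => x /=; rewrite in_itv /= => abx Px.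
  by apply: noP; exists x.
have : mu `]a, b[%classic = 0%E by exact: measure_negligible null.
rewrite lebesgue_measure_itv /= lte_fin ab => /eqP.
by rewrite -EFinB eqe subr_eq0 gt_eqF.
Qed.

(** Every right neighbourhood of t0 has positive measure, hence contains a point
where the continuation equals the exponential, so t0 is an accumulation point of
coincidences. *)
Lemma continuation_value_cexp u J (A b p v : R[i]) (t0 : R) :
  open J -> J t0 ->
  {ae mu, forall t, J t -> u t = A * cexp (b * t%:C)} ->
  continuation_value u J p v -> v = A * cexp (b * p).
Proof.
move=> oJ Jt0 ueq [D [U [anU [JD Dp Uu ->]]]].
apply: (identity_theorem anU (V := fun w => A * cexp (b * w)) (p := t0%:C)) => //.
- by move=> q _; exact: analytic_cexp.
- exact: JD.
move=> [e e']; rewrite ltcE /= => /andP[/eqP -> e0].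
have /nbhs_ballP [d /= d0 dJ] : nbhs t0 J by exact: open_nbhs_nbhs.
pose m := Num.min e d.
have m0 : 0 < m by rewrite lt_min e0.
have agree : {ae mu, forall t, J t -> U t%:C = A * cexp (b * t%:C)}.
  by apply: ae_imply2 Uu ueq => t Ut ut Jt; rewrite Ut // ut.
have [t /andP[t0t tm] Ut] : exists2 t, t0 < t < t0 + m &
    (J t -> U t%:C = A * cexp (b * t%:C)).
  by apply: ae_exists_itv agree; rewrite ltrDl.
have tm' : `|t - t0| < m.
  by rewrite ger0_norm ?subr_ge0 ?(ltW t0t) // ltrBlDl.
exists t%:C.
  rewrite -rmorphB normr_normc /= expr0n addr0 sqrtr_sqr.
  rewrite -[0]/(0%:C) -[e +i* 0]/(e%:C) !ltcR normr_gt0 subr_eq0 gt_eqF //=.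
  by rewrite (lt_le_trans tm') // ge_min lexx.
apply: Ut; apply: dJ; rewrite /ball /= distrC (lt_le_trans tm') //.
by rewrite ge_min lexx orbT.
Qed.

End Continuation.

(** * Integrals of complex-valued functions *)

Section ComplexIntegral.
Variable R : realType.
Implicit Types (f g h : R -> R[i]) (c w kt : R[i]) (D : set R) (l x : R).
Local Notation mu := (@lebesgue_measure R).
Local Notation Re := complex.Re.
Local Notation Im := complex.Im.

Lemma cmeasurableM f g : cmeasurable f -> cmeasurable g ->
  cmeasurable (fun x => f x * g x).
Proof.
move=> [rf jf] [rg jg]; split.
  under eq_fun do rewrite ReM.
  by apply: measurable_funB; exact: measurable_funM.
under eq_fun do rewrite ImM.
by apply: measurable_funD; exact: measurable_funM.
Qed.

Lemma cmeasurable_cst c : cmeasurable (fun _ : R => c).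
Proof. by split; exact: measurable_cst. Qed.

Lemma cmeasurable_cexp w : cmeasurable (fun x : R => cexp (w * x%:C)).
Proof.
have lin (a : R) : measurable_fun setT (fun x : R => a * x).
  by apply: measurable_funM => //; exact: measurable_cst.
have re (x : R) : Re (w * x%:C) = Re w * x by rewrite ReM /= mulr0 subr0.
have im (x : R) : Im (w * x%:C) = Im w * x by rewrite ImM /= mulr0 add0r.
split; rewrite /cexp /=.
  under eq_fun do rewrite re im.
  apply: measurable_funM.
    exact: (measurableT_comp (@measurable_expR R) (lin _)).
  apply: (measurableT_comp _ (lin _)).
  exact: continuous_measurable_fun (@continuous_cos R).
under eq_fun do rewrite re im.
apply: measurable_funM.
  exact: (measurableT_comp (@measurable_expR R) (lin _)).
apply: (measurableT_comp _ (lin _)).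
exact: continuous_measurable_fun (@continuous_sin R).
Qed.

Lemma cmeasurable_if (b : R -> bool) f g : measurable_fun setT b ->
  cmeasurable f -> cmeasurable g -> cmeasurable (fun x => if b x then f x else g x).
Proof.
move=> mb [rf jf] [rg jg]; split.
  have -> : (fun x => Re (if b x then f x else g x))
      = (fun x => if b x then Re (f x) else Re (g x)).
    by apply/funext => x; case: (b x).
  exact: measurable_fun_ifT.
have -> : (fun x => Im (if b x then f x else g x))
    = (fun x => if b x then Im (f x) else Im (g x)).
  by apply/funext => x; case: (b x).
exact: measurable_fun_ifT.
Qed.

Lemma cmeasurable_green kt x : cmeasurable (green kt x).
Proof.
have e1 (y : R) : - ('i%C * kt * y%:C) = - ('i%C * kt) * y%:C by rewrite mulNr.
apply: cmeasurable_if; first exact: measurable_fun_ler.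
  under eq_fun do rewrite e1.
  by apply: cmeasurableM; [exact: cmeasurable_cst|exact: cmeasurable_cexp].
by apply: cmeasurableM; [exact: cmeasurable_cst|exact: cmeasurable_cexp].
Qed.

Lemma measurable_normc f : cmeasurable f -> measurable_fun setT (fun x => normc (f x)).
Proof.
move=> [rf jf].
have -> : (fun x => normc (f x))
    = (fun x => (Re (f x) ^+ 2 + Im (f x) ^+ 2) `^ 2^-1).
  apply/funext => x; rewrite powR12_sqrt ?addr_ge0 ?sqr_ge0 //.
  by case: (f x).
apply: (measurableT_comp (measurable_powR _)).
by apply: measurable_funD; exact: measurable_funX.
Qed.

Lemma cintegral_restrict f D : measurable (D : set (measurableTypeR R)) -> cmeasurable f ->
  {ae mu, forall x, ~ D x -> f x = 0} -> cintegral setT f = cintegral D f.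
Proof.
move=> mD [rf jf] f0.
have key (r : R[i] -> R) : r 0 = 0 -> measurable_fun setT (fun x => r (f x)) ->
    \int[mu]_x r (f x) = \int[mu]_(x in D) r (f x).
  move=> r0 mr; rewrite [RHS]Rintegral_mkcond /Rintegral; congr fine.
  apply: ae_eq_integral => //.
  - exact/measurable_EFinP.
  - by apply/measurable_EFinP; apply/(measurable_restrictT _ mD); exact: measurable_funS mr.
  - apply: ae_imply f0 => x fx _ /=; congr EFin; rewrite patchE.
    by case: ifPn => // /negP; rewrite inE => /fx ->.
by rewrite /cintegral !key.
Qed.

Lemma cintegralZl D c f : measurable (D : set (measurableTypeR R)) -> cintegrable D f ->
  cintegral D (fun x => c * f x) = c * cintegral D f.
Proof.
move=> mD [rf jf]; rewrite /cintegral.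
have ReZ (a b : R) : \int[mu]_(x in D) (a * Re (f x) + b * Im (f x))
    = a * (\int[mu]_(x in D) Re (f x)) + b * (\int[mu]_(x in D) Im (f x)).
  have ia : mu.-integrable D (EFin \o (fun x => a * Re (f x))).
    exact: (integrableZl mD a rf).
  have ib : mu.-integrable D (EFin \o (fun x => b * Im (f x))).
    exact: (integrableZl mD b jf).
  by rewrite RintegralD // !RintegralZl.
apply/eqP; rewrite eq_complex ReM ImM /=; apply/andP; split; apply/eqP.
  rewrite -mulNr -ReZ; apply: eq_Rintegral => x _; rewrite ReM; ring.
rewrite addrC -ReZ; apply: eq_Rintegral => x _; rewrite ImM; ring.
Qed.

(** Rotate the integral z to the positive axis: normc z ^ 2 is the integral of
Re (conjc z * f), which is at most normc z * normc f. *)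
Lemma normc_cintegral_le D f : measurable (D : set (measurableTypeR R)) -> cintegrable D f ->
  mu.-integrable D (fun x => (normc (f x))%:E) ->
  normc (cintegral D f) <= \int[mu]_(x in D) normc (f x).
Proof.
move=> mD intf intn; set z := cintegral D f.
have [->|z0] := eqVneq (normc z) 0.
  by apply: Rintegral_ge0 => x _; exact: normc_ge0.
have zp : 0 < normc z by rewrite lt_def z0 normc_ge0.
rewrite -(ler_pM2l zp) -expr2 normc_Re_conj -cintegralZl //.
rewrite -[Re (cintegral _ _)]/(\int[mu]_(x in D) Re (conjc z * f x)) -RintegralZl //.
apply: le_Rintegral => //.
- case: intf => rf jf.
  have -> : EFin \o (fun x => Re (conjc z * f x)) =
     (fun x => (Re z)%:E * (Re (f x))%:E + (Im z)%:E * (Im (f x))%:E)%E.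
    apply/funext => x; rewrite -!EFinM -EFinD; congr EFin.
    by rewrite ReM Re_conj Im_conj; ring.
  by apply: integrableD => //; exact: integrableZl.
- exact: (integrableZl mD (normc z) intn).
- by move=> x _; rewrite (le_trans (Re_le_normc _)) // normcM normc_conj.
Qed.

End ComplexIntegral.

(** * The amplitude of the exterior wave *)

Section CauchySchwarz.
Variable R : realType.
Implicit Types (f : R -> R[i]) (w kt : R[i]) (l x : R).
Local Notation mu := (@lebesgue_measure R).
Local Notation Re := complex.Re.
Local Notation Im := complex.Im.

Lemma Lnorm2_restrict_le (D : set R) f : measurable (D : set (measurableTypeR R)) ->
  cmeasurable f ->
  (Lnorm mu 2%:E (EFin \o ((fun x => normc (f x)) \_ D))
    <= Lnorm mu 2%:E (EFin \o (fun x => normc (f x))))%E.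
Proof.
move=> mD /measurable_normc mf; rewrite unlock.
have mpow (g : R -> R) : measurable_fun setT g ->
    measurable_fun setT (fun x => (`|(EFin \o g) x| `^ 2)%E).
  move=> mg; have -> : (fun x => (`|(EFin \o g) x| `^ 2)%E) = EFin \o (fun x => `|g x| `^ 2).
    by apply/funext => x.
  apply/measurable_EFinP; apply: (measurableT_comp (measurable_powR _)).
  exact: measurableT_comp mg.
apply: gt0_ler_poweR; first by rewrite invr_ge0.
- by rewrite in_itv /= leey andbT integral_ge0 // => x _; exact: poweR_ge0.
- by rewrite in_itv /= leey andbT integral_ge0 // => x _; exact: poweR_ge0.
apply: ge0_le_integral => //.
- by move=> x _; exact: poweR_ge0.
- by apply: mpow; apply/(measurable_restrictT _ mD); exact: measurable_funS mf.
- exact: mpow.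
- move=> x _; apply: gt0_ler_poweR => //; rewrite ?in_itv /= ?leey ?lee_fin ?normr_ge0 //.
  by rewrite patchE; case: ifPn => // _; rewrite normr0 normr_ge0.
Qed.

(** Cauchy-Schwarz against the indicator of [-l, l], whose norm is sqrt (2 l). *)
Lemma L1_le_L2 l f : 0 < l -> in_L2 f ->
  (\int[mu]_(x in [set` `[- l, l]%R]) (normc (f x))%:E
    <= (Num.sqrt (2 * l) * L2norm `[- l, l] f)%:E)%E.
Proof.
move=> l0 [mf ff]; set D := `[- l, l]%classic.
have mD : measurable (D : set (measurableTypeR R)) by exact: measurable_itv.
have mn := measurable_normc mf.
set g := (fun x => normc (f x)) \_ D.
have mg : measurable_fun setT g.
  by apply/(measurable_restrictT _ mD); exact: measurable_funS mn.
have ffin : (Lnorm mu 2%:E (EFin \o g) < +oo)%E.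
  exact: le_lt_trans (Lnorm2_restrict_le mD mf) ff.
have mD1 : measurable_fun setT (\1_D : R -> R) by exact/measurable_indicP.
have half : 2^-1 + 2^-1 = 1 :> R by field.
have H := hoelder (p := 2) (q := 2) mu mD1 mg (ltr0Sn _ 1) (ltr0Sn _ 1) half.
have muD : mu D = (2 * l)%:E.
  by rewrite /D lebesgue_measure_itv /= lte_fin gtrN // -EFinB opprK mulr_natl.
have N2D : Lnorm mu 2%:E (EFin \o (\1_D : R -> R)) = (Num.sqrt (2 * l))%:E.
  rewrite unlock.
  have -> : (\int[mu]_x (`|(EFin \o \1_D) x| `^ 2)%E = (2 * l)%:E)%E.
    transitivity (\int[mu]_x (\1_D x)%:E)%E.
      apply: eq_integral => x _; rewrite /= indicE.
      by case: (x \in D); rewrite ?normr1 ?powR1 // normr0 powR0.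
    by rewrite integral_indic // setIT.
  by rewrite poweR_EFin powR12_sqrt // mulr_ge0 // ltW.
have -> : (\int[mu]_(x in D) (normc (f x))%:E)%E = Lnorm mu 1 (EFin \o (\1_D \* g)).
  rewrite Lnorm1 [LHS]integral_mkcond; apply: eq_integral => x _.
  rewrite /= /g !patchE indicE; case: ifPn => _; last by rewrite mul0r normr0.
  by rewrite mul1r ger0_norm // normc_ge0.
apply: (le_trans H); rewrite N2D EFinM lee_wpmul2l ?lee_fin ?sqrtr_ge0 //.
by rewrite /L2norm fineK // ge0_fin_numE ?Lnorm_ge0.
Qed.

Lemma integrable_normc_itv l f : 0 < l -> in_L2 f ->
  mu.-integrable `[- l, l] (fun x => (normc (f x))%:E).
Proof.
move=> l0 f2; have [mf _] := f2; apply/integrableP; split.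
  by apply/measurable_EFinP; exact: measurable_funS (measurable_normc mf).
under eq_integral => x _ do rewrite gee0_abs ?lee_fin ?normc_ge0 //.
exact: le_lt_trans (L1_le_L2 l0 f2) (ltry _).
Qed.

Lemma normr_Re_le (z : R[i]) : `|Re z| <= normc z.
Proof.
rewrite ler_norml Re_le_normc andbT lerNl; case: z => a b.
by rewrite -[- _]/(Re (- (a +i* b))) -normcN Re_le_normc.
Qed.

Lemma normr_Im_le (z : R[i]) : `|Im z| <= normc z.
Proof.
have -> : Im z = Re (- 'i%C * z) by case: z => a b /=; ring.
by rewrite (le_trans (normr_Re_le _)) // normcM normcN /= expr0n expr1n add0r sqrtr1 mul1r.
Qed.

Lemma normc_cexp_itv_le w l x : x \in `[- l, l] ->
  normc (cexp (w * x%:C)) <= expR (`|Re w| * l).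
Proof.
rewrite in_itv => xl; rewrite normc_cexp ler_expR.
rewrite ReM [Re _%:C]/= [Im _%:C]/= mulr0 subr0.
apply: (le_trans (ler_norm _)); rewrite normrM ler_wpM2l //.
by rewrite ler_norml.
Qed.

Lemma integrable_cexpM_itv l w f : 0 < l -> in_L2 f ->
  let h := fun x => cexp (w * x%:C) * f x in
  cintegrable `[- l, l] h /\ mu.-integrable `[- l, l] (fun x => (normc (h x))%:E).
Proof.
move=> l0 f2 h; have [mf _] := f2.
have mh : cmeasurable h by apply: cmeasurableM => //; exact: cmeasurable_cexp.
have mD : measurable (`[- l, l]%classic : set (measurableTypeR R)) by exact: measurable_itv.
have hle x : `[- l, l]%classic x -> normc (h x) <= expR (`|Re w| * l) * normc (f x).
  by move=> xD; rewrite normcM ler_wpM2r ?normc_ge0 // normc_cexp_itv_le.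
have key (r : R[i] -> R) : (forall z, `|r z| <= normc z) ->
    measurable_fun setT (fun x => r (h x)) ->
    mu.-integrable `[- l, l] (fun x => (r (h x))%:E).
  move=> rle mr.
  apply: (le_integrable mD _ _
    (integrableZl mD (expR (`|Re w| * l)) (integrable_normc_itv l0 f2))).
    by apply/measurable_EFinP; exact: measurable_funS mr.
  move=> x xD; rewrite -EFinM !abse_EFin lee_fin (le_trans (rle _)) //.
  rewrite (le_trans (hle x xD)) //.
  exact: ler_norm.
split; last by apply: key (measurable_normc mh) => z; rewrite ger0_norm ?normc_ge0.
by case: mh => mr mi; split; [exact: key normr_Re_le mr|exact: key normr_Im_le mi].
Qed.

Lemma normc_cintegral_cexp_le l w f : 0 < l -> in_L2 f ->
  normc (cintegral `[- l, l] (fun x => cexp (w * x%:C) * f x))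
    <= expR (`|Re w| * l) * (Num.sqrt (2 * l) * L2norm `[- l, l] f).
Proof.
move=> l0 f2; have [ih inh] := integrable_cexpM_itv w l0 f2.
have mD : measurable (`[- l, l]%classic : set (measurableTypeR R)) by exact: measurable_itv.
have inf := integrable_normc_itv l0 f2.
apply: (le_trans (normc_cintegral_le mD ih inh)).
apply: (@le_trans _ _ (expR (`|Re w| * l) * \int[mu]_(x in `[- l, l]) normc (f x))).
  rewrite -RintegralZl //; apply: le_Rintegral => //.
    exact: (integrableZl mD _ inf).
  move=> x xD; rewrite normcM ler_wpM2r ?normc_ge0 //.
  exact: normc_cexp_itv_le.
rewrite ler_wpM2l ?expR_ge0 // -lee_fin; apply: le_trans (L1_le_L2 l0 f2).
by rewrite /Rintegral fineK // integrable_fin_num.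
Qed.

End CauchySchwarz.

(** * The exterior solution *)

Section ExteriorBound.
Variable R : realType.
Implicit Types (f u V : R -> R[i]) (b kt z : R[i]) (sigma : R -> R) (k l x : R).
Local Notation mu := (@lebesgue_measure R).
Local Notation Re := complex.Re.
Local Notation Im := complex.Im.

(** f vanishes almost everywhere off [-l, l], whose points lie to the left of x;
there Green's function factors as a function of x times a function of y. *)
Lemma cintegral_green_right kt l f x : 0 < l -> in_L2 f ->
  {ae mu, forall y, l < `|y| -> f y = 0} -> l < x ->
  cintegral setT (fun y => green kt x y * f y) =
    - (cexp ('i%C * kt * x%:C) / (2 * 'i%C * kt))
    * cintegral `[- l, l] (fun y => cexp (- ('i%C * kt) * y%:C) * f y).
Proof.
move=> l0 f2 f0 lx; have [mf _] := f2.
have mD : measurable (`[- l, l]%classic : set (measurableTypeR R)) by exact: measurable_itv.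
rewrite (cintegral_restrict mD).
- rewrite -cintegralZl //; last by case: (integrable_cexpM_itv (- ('i%C * kt)) l0 f2).
  have eqD y : y \in (`[- l, l]%classic : set R) ->
      green kt x y * f y = - (cexp ('i%C * kt * x%:C) / (2 * 'i%C * kt))
        * (cexp (- ('i%C * kt) * y%:C) * f y).
    rewrite inE => yD.
    have /andP[_ yl] : - l <= y <= l by move: yD; rewrite /= in_itv.
    by rewrite /green (le_trans yl (ltW lx)) (mulNr _ y%:C) mulrA.
  by rewrite /cintegral; congr (_ +i* _); apply: eq_Rintegral => y /eqD ->.
- by apply: cmeasurableM => //; exact: cmeasurable_green.
- apply: ae_imply f0 => y fy yD; rewrite fy ?mulr0 // ltNge; apply/negP.
  by rewrite ler_norml => yl; apply: yD; rewrite /= in_itv.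
Qed.

Lemma cintegral_green_left kt l f x : 0 < l -> in_L2 f ->
  {ae mu, forall y, l < `|y| -> f y = 0} -> x < - l ->
  cintegral setT (fun y => green kt x y * f y) =
    - (cexp (- ('i%C * kt) * x%:C) / (2 * 'i%C * kt))
    * cintegral `[- l, l] (fun y => cexp ('i%C * kt * y%:C) * f y).
Proof.
move=> l0 f2 f0 lx; have [mf _] := f2.
have mD : measurable (`[- l, l]%classic : set (measurableTypeR R)) by exact: measurable_itv.
rewrite (cintegral_restrict mD).
- rewrite -cintegralZl //; last by case: (integrable_cexpM_itv ('i%C * kt) l0 f2).
  have eqD y : y \in (`[- l, l]%classic : set R) ->
      green kt x y * f y = - (cexp (- ('i%C * kt) * x%:C) / (2 * 'i%C * kt))
        * (cexp ('i%C * kt * y%:C) * f y).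
    rewrite inE => yD.
    have /andP[yl _] : - l <= y <= l by move: yD; rewrite /= in_itv.
    by rewrite /green leNgt (lt_le_trans lx yl) (mulNr _ x%:C) mulrA.
  by rewrite /cintegral; congr (_ +i* _); apply: eq_Rintegral => y /eqD ->.
- by apply: cmeasurableM => //; exact: cmeasurable_green.
- apply: ae_imply f0 => y fy yD; rewrite fy ?mulr0 // ltNge; apply/negP.
  by rewrite ler_norml => yl; apply: yD; rewrite /= in_itv.
Qed.

Lemma primitive_ge0 sigma x : (forall t, 0 <= sigma t) -> 0 <= x -> 0 <= primitive sigma x.
Proof. by move=> s0 x0; rewrite /primitive x0; apply: Rintegral_ge0. Qed.

Lemma primitive_le0 sigma x : (forall t, 0 <= sigma t) -> x < 0 -> primitive sigma x <= 0.
Proof.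
move=> s0 x0; rewrite /primitive (lt_geF x0) oppr_le0.
exact: Rintegral_ge0.
Qed.

Lemma Im_wave_pml_coord kt k (z1 z2 : R) sigma x :
  Im (kt * pml_coord k (z1 +i* z2) sigma x) =
    Im kt * (x + z1 / k * primitive sigma x) + Re kt * (z2 / k * primitive sigma x).
Proof.
rewrite /pml_coord -fmorphV; move: (primitive sigma x) (k^-1) => P h.
by rewrite ImM ReD ImD !(ReM, ImM) /=; ring.
Qed.

Lemma ImN b : Im (- b) = - Im b.
Proof. by case: b. Qed.

Lemma ReiM b : Re ('i%C * b) = - Im b.
Proof. by case: b => x y /=; ring. Qed.

(** Here b is the exponent in the amplitude integral, - i kt or i kt according to
the side, and w is the exponent of the wave at the point of evaluation. The
constant comes from sqrt (2 l) / 2 = sqrt l / sqrt 2. *)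
Lemma wave_amplitude_le kt b w l f (c0 : R) :
  0 < l -> in_L2 f -> 0 <= c0 -> kt != 0 -> `|Re b| = Im kt ->
  normc (c0%:C * (- (2 * 'i%C * kt)^-1
          * cintegral `[- l, l] (fun y => cexp (b * y%:C) * f y)) * cexp w)
    <= c0 * (Num.sqrt l / (Num.sqrt 2 * normc kt))
         * expR (Im kt * l + Re w) * L2norm `[- l, l] f.
Proof.
move=> l0 f2 c00 kt0 Reb; have := normc_cintegral_cexp_le b l0 f2.
rewrite Reb; set I := cintegral _ _; set N := L2norm _ _ => IN.
have n0 : 0 < normc kt.
  by rewrite lt_def normc_ge0 andbT; apply: contra_neq kt0 => /eq0_normc.
have s2 : 0 < Num.sqrt 2 :> R by rewrite sqrtr_gt0.
rewrite !normcM normcN normcV !normcM normc_cexp.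
have -> : normc c0%:C = c0 by rewrite /= expr0n addr0 sqrtr_sqr ger0_norm.
have -> : normc 2 = 2 :> R.
  by rewrite -(rmorph_nat (real_complex R)) /= expr0n addr0 sqrtr_sqr ger0_norm.
have -> : normc 'i%C = 1 :> R by rewrite /= expr0n expr1n add0r sqrtr1.
rewrite mulr1 expRD.
have -> : c0 * (Num.sqrt l / (Num.sqrt 2 * normc kt)) * (expR (Im kt * l) * expR (Re w)) * N
  = c0 * ((2 * normc kt)^-1 * (expR (Im kt * l) * (Num.sqrt (2 * l) * N))) * expR (Re w).
  have -> : (2 * normc kt)^-1 = (Num.sqrt 2 ^+ 2 * normc kt)^-1 by rewrite sqr_sqrtr.
  rewrite sqrtrM //.
  by field; rewrite !gt_eqF.
rewrite ler_wpM2r ?expR_ge0 // ler_wpM2l // ler_wpM2l //.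
by rewrite invr_ge0 mulr_ge0 // ltW.
Qed.

(** Both sides give the same exponent because x and the primitive of sigma change
sign together with the direction of the outgoing wave. *)
Lemma exterior_bound kt k l (z1 z2 c0 : R) sigma f u V :
  0 < l -> in_L2 f -> {ae mu, forall y, l < `|y| -> f y = 0} ->
  (forall t, 0 <= sigma t) -> 0 <= c0 -> kt != 0 -> 0 <= Im kt ->
  {ae mu, forall x, l < `|x| ->
    u x = c0%:C * cintegral setT (fun y => green kt x y * f y)} ->
  is_pml_solution k l (z1 +i* z2) sigma u V ->
  forall x, l < `|x| ->
    normc (V x) <= c0 * (Num.sqrt l / (Num.sqrt 2 * normc kt))
      * expR (- (Im kt * (`|x| + z1 / k * pml_eta sigma x - l)
                 + Re kt * (z2 / k * pml_eta sigma x)))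
      * L2norm `[- l, l] f.
Proof.
move=> l0 f2 f0 s0 c00 kt0 Imkt ueq pml x lx.
have [[{}lx cont]|[{}lx cont]] := pml x lx.
  have x0 := lt_trans l0 lx.
  pose I := cintegral `[- l, l] (fun y => cexp (- ('i%C * kt) * y%:C) * f y).
  have -> : V x = c0%:C * (- (2 * 'i%C * kt)^-1 * I)
      * cexp ('i%C * kt * pml_coord k (z1 +i* z2) sigma x).
    apply: (continuation_value_cexp (t0 := x) _ _ _ cont).
    - exact: rray_open.
    - by rewrite /= in_itv /= andbT.
    - apply: ae_imply ueq => t ut; rewrite /= in_itv /= andbT => lt.
      rewrite ut ?gtr0_norm ?(lt_trans l0) //.
      by rewrite (cintegral_green_right kt l0 f2 f0 lt) -/I; ring.
  apply: (le_trans (wave_amplitude_le _ l0 f2 c00 kt0 _)).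
    by rewrite -mulrN ReiM ImN opprK ger0_norm.
  rewrite ler_wpM2r //; first by rewrite /L2norm fine_ge0 // Lnorm_ge0.
  rewrite ler_wpM2l //; first by rewrite !(mulr_ge0, invr_ge0, sqrtr_ge0, normc_ge0).
  rewrite ler_expR.
  rewrite -mulrA ReiM Im_wave_pml_coord /pml_eta (gtr0_norm x0).
  by rewrite ger0_norm ?primitive_ge0 ?(ltW x0) // le_eqVlt; apply/orP; left; apply/eqP; ring.
have x0 : x < 0 by rewrite (lt_trans lx) // oppr_lt0.
pose I := cintegral `[- l, l] (fun y => cexp ('i%C * kt * y%:C) * f y).
have -> : V x = c0%:C * (- (2 * 'i%C * kt)^-1 * I)
    * cexp (- ('i%C * kt) * pml_coord k (z1 +i* z2) sigma x).
  apply: (continuation_value_cexp (t0 := x) _ _ _ cont).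
  - exact: lray_open.
  - by rewrite /= in_itv.
  - apply: ae_imply ueq => t ut; rewrite /= in_itv /= => lt.
    have t0 : t < 0 by rewrite (lt_trans lt) // oppr_lt0.
    have lt' : l < `|t| by rewrite (ltr0_norm t0) ltrNr.
    by rewrite (ut lt') (cintegral_green_left kt l0 f2 f0 lt) -/I; ring.
apply: (le_trans (wave_amplitude_le _ l0 f2 c00 kt0 _)).
  by rewrite ReiM normrN ger0_norm.
rewrite ler_wpM2r //; first by rewrite /L2norm fine_ge0 // Lnorm_ge0.
rewrite ler_wpM2l //; first by rewrite !(mulr_ge0, invr_ge0, sqrtr_ge0, normc_ge0).
rewrite ler_expR.
rewrite (mulNr ('i%C * kt)) -(mulrA 'i%C) -mulrN ReiM ImN opprK.
rewrite Im_wave_pml_coord /pml_eta (ltr0_norm x0).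
by rewrite ler0_norm ?primitive_le0 // le_eqVlt; apply/orP; left; apply/eqP; ring.
Qed.

(** Here a + i b is the wave number and e is eta. The hypothesis on z1 / z2 amounts
to a z2 >= - (1 - lam) b z1: a possibly negative a z2 e / k is paid for by the
fraction 1 - lam of b z1 e / k, and the fraction lam remains. On the left
half-line x and z1 e / k have opposite signs, which only decreases the left-hand
side. *)
Lemma pml_exponent_le (a b k l lam z1 z2 x e : R) :
  0 < k -> 0 < b -> 0 < lam < 1 -> 0 < z2 -> 0 <= z1 -> 0 <= e -> l < `|x| ->
  - (1 / (1 - lam)) * (a / b) <= z1 / z2 ->
  lam * b * (`|x + z1 / k * e| - l)
    <= b * (`|x| + z1 / k * e - l) + a * (z2 / k * e).
Proof.
move=> k0 b0 /andP[lam0 lam1] z20 z10 e0 lx.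
rewrite ler_pdivlMr // => hz.
have lamp : 0 < 1 - lam by rewrite subr_gt0.
have key : 0 <= (1 - lam) * b * z1 + a * z2.
  have := ler_wpM2l (ltW (mulr_gt0 lamp b0)) hz.
  have -> : (1 - lam) * b * (- (1 / (1 - lam)) * (a / b) * z2) = - (a * z2).
    by field; rewrite !gt_eqF.
  lra.
have ek : 0 <= e / k by rewrite divr_ge0 // ltW.
have tri : `|x + z1 / k * e| <= `|x| + z1 / k * e.
  by rewrite (le_trans (ler_normD _ _)) // lerD2l ger0_norm // mulr_ge0 // divr_ge0 // ltW.
have : lam * b * (`|x + z1 / k * e| - l) <= lam * b * (`|x| + z1 / k * e - l).
  by apply: ler_wpM2l; [rewrite mulr_ge0 // ltW|rewrite lerD2r].
move/le_trans; apply.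
rewrite -subr_ge0.
have -> : b * (`|x| + z1 / k * e - l) + a * (z2 / k * e) - lam * b * (`|x| + z1 / k * e - l)
  = (1 - lam) * b * (`|x| - l) + ((1 - lam) * b * z1 + a * z2) * (e / k) by ring.
by rewrite addr_ge0 // mulr_ge0 // ?subr_ge0 ?ltW // mulr_gt0.
Qed.

(** The two kernels differ only by the real factor c0 in front of the Green
integral. *)
Lemma pml_estimates kt k l (z1 z2 c0 : R) sigma f u V :
  0 < k -> 0 < l -> in_L2 f -> {ae mu, forall y, l < `|y| -> f y = 0} ->
  (forall t, 0 <= sigma t) -> 0 <= z1 -> 0 < z2 -> 0 <= c0 ->
  {ae mu, forall x, l < `|x| ->
    u x = c0%:C * cintegral setT (fun y => green kt x y * f y)} ->
  is_pml_solution k l (z1 +i* z2) sigma u V ->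
  (forall r : R, kt = r%:C -> 0 < r -> forall x, l < `|x| ->
    normc (V x) <= c0 * (Num.sqrt l / (Num.sqrt 2 * r))
      * expR (- (r / k * z2 * `|pml_eta sigma x|)) * L2norm `[- l, l] f) /\
  (0 < Im kt -> forall lam : R, 0 < lam < 1 ->
    - (1 / (1 - lam)) * (Re kt / Im kt) <= z1 / z2 -> forall x, l < `|x| ->
    normc (V x) <= c0 * (Num.sqrt l / (Num.sqrt 2 * normc kt))
      * expR (- (lam * Im kt * (`|x + z1 / k * pml_eta sigma x| - l)))
      * L2norm `[- l, l] f).
Proof.
move=> k0 l0 f2 f0 s0 z10 z20 c00 ueq pml; split.
  move=> r ktE r0 x lx.
  have kt0 : kt != 0 by rewrite ktE eq_complex /= gt_eqF.
  have Im0 : 0 <= Im kt by rewrite ktE.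
  apply: (le_trans (exterior_bound l0 f2 f0 s0 c00 kt0 Im0 ueq pml lx)).
  rewrite ktE /= expr0n addr0 sqrtr_sqr gtr0_norm //.
  have -> : `|pml_eta sigma x| = pml_eta sigma x by rewrite normr_id.
  rewrite le_eqVlt; apply/orP; left; apply/eqP; congr (_ * expR _ * _); ring.
move=> Im0 lam lam01 hz x lx.
have kt0 : kt != 0 by apply: contraTneq Im0 => ->; rewrite /= ltxx.
apply: (le_trans (exterior_bound l0 f2 f0 s0 c00 kt0 (ltW Im0) ueq pml lx)).
rewrite ler_wpM2r //; first by rewrite /L2norm fine_ge0 // Lnorm_ge0.
rewrite ler_wpM2l //; first by rewrite !(mulr_ge0, invr_ge0, sqrtr_ge0, normc_ge0).
rewrite ler_expR lerN2; apply: (pml_exponent_le k0 Im0 lam01 z20 z10) => //.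
exact: normr_ge0.
Qed.

End ExteriorBound.

Theorem theorem3p1 (R : realType) (k l : R) (f : R -> R[i]) (sigma : R -> R)
    (z1 z2 : R)
    (k_gt0 : 0 < k) (l_gt0 : 0 < l)
    (f_L2 : in_L2 f)
    (f_supp : {ae (@lebesgue_measure R), forall x, l < `|x| -> f x = 0})
    (sigma_loc : locally_integrable [set: R] sigma)
    (sigma_ge0 : forall x, 0 <= sigma x)
    (sigma_eq0 : forall x, `|x| <= l -> sigma x = 0)
    (sigma_gt0 : forall x, l < `|x| -> 0 < sigma x)
    (z1_ge0 : 0 <= z1) (z2_gt0 : 0 < z2) :
  let eta := pml_eta sigma in
  let normf := L2norm `[- l, l] f in
  (forall (gam : R -> R) (kt : R[i]) (u ua_pml : R -> R[i]),
    is_radial_kernel gam ->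
    is_radial_wavenumber gam k kt ->
    is_helmholtz_solution gam k f u ->
    radial_representation kt gam f u ->
    is_pml_solution k l (z1 +i* z2) sigma (average kt gam u) ua_pml ->
    (forall r : R, kt = r%:C -> 0 < r ->
      forall x, l < `|x| ->
        normc (ua_pml x) <=
          Num.sqrt l / (Num.sqrt 2 * r)
          * expR (- (r / k * z2 * `|eta x|)) * normf) /\
    (0 < complex.Im kt -> forall lam : R, 0 < lam < 1 ->
      - (1 / (1 - lam)) * (complex.Re kt / complex.Im kt) <= z1 / z2 ->
      forall x, l < `|x| ->
        normc (ua_pml x) <=
          Num.sqrt l / (Num.sqrt 2 * normc kt)
          * expR (- (lam * complex.Im kt * (`|x + z1 / k * eta x| - l))) * normf)) /\
  (forall (c : R) (ue ue_pml : R -> R[i]),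
    0 < c -> c * k != 1 ->
    is_helmholtz_solution (exp_kernel c) k f ue ->
    exp_representation c k f ue ->
    is_pml_solution k l (z1 +i* z2) sigma ue ue_pml ->
    let kt := exp_wavenumber c k in
    (forall r : R, kt = r%:C -> 0 < r ->
      forall x, l < `|x| ->
        normc (ue_pml x) <=
          Num.sqrt l / (Num.sqrt 2 * r * (1 - (c * k) ^+ 2) ^+ 2)
          * expR (- (r / k * z2 * `|eta x|)) * normf) /\
    (0 < complex.Im kt -> forall lam : R, 0 < lam < 1 ->
      - (1 / (1 - lam)) * (complex.Re kt / complex.Im kt) <= z1 / z2 ->
      forall x, l < `|x| ->
        normc (ue_pml x) <=
          Num.sqrt l / (Num.sqrt 2 * normc kt * (1 - (c * k) ^+ 2) ^+ 2)
          * expR (- (lam * complex.Im kt * (`|x + z1 / k * eta x| - l))) * normf)).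
Proof.
move=> eta normf; split.
  move=> gam kt u ua_pml _ _ _ rep pml.
  have ueq : {ae (@lebesgue_measure R), forall x, l < `|x| -> average kt gam u x
      = 1%:C * cintegral setT (fun y => green kt x y * f y)}.
    by apply: ae_imply rep => x -> _; rewrite mul1r.
  have [est1 est2] := pml_estimates k_gt0 l_gt0 f_L2 f_supp sigma_ge0 z1_ge0 z2_gt0
    ler01 ueq pml.
  split.
    by move=> r ktr r0 x lx; have := est1 r ktr r0 x lx; rewrite mul1r.
  by move=> Im0 lam lam01 hz x lx; have := est2 Im0 lam lam01 hz x lx; rewrite mul1r.
move=> c ue ue_pml _ _ _ rep pml kt.
set q := (1 - (c * k) ^+ 2) ^+ 2.
have q0 : 0 <= 1 / q by rewrite div1r invr_ge0 sqr_ge0.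
have ueq : {ae (@lebesgue_measure R), forall x, l < `|x| -> ue x
    = (1 / q)%:C * cintegral setT (fun y => green kt x y * f y)}.
  by apply: ae_imply2 rep f_supp => x -> fx lx; rewrite (fx lx) mulr0 addr0.
have [est1 est2] := pml_estimates k_gt0 l_gt0 f_L2 f_supp sigma_ge0 z1_ge0 z2_gt0
  q0 ueq pml.
have cst s : 1 / q * (Num.sqrt l / (Num.sqrt 2 * s)) = Num.sqrt l / (Num.sqrt 2 * s * q).
  by rewrite div1r [_ * q]mulrC (invfM q) mulrCA.
split.
  by move=> r ktr r0 x lx; have := est1 r ktr r0 x lx; rewrite cst.
by move=> Im0 lam lam01 hz x lx; have := est2 Im0 lam lam01 hz x lx; rewrite cst.
Qed.
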